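(* Let $\eta$ be irrational, let $X=\mathbb{T}=\mathbb{R}/\mathbb{Z}$ (identified with $[0,1)$) with its Borel $\sigma$-algebra $\mathcal{B}$ and normalized Lebesgue measure $\lambda$, and let $T(x)=x+\eta \pmod 1$. Let $A$ be the matrix cocycle over $T$ generated by \[ A(1,x)=\begin{bmatrix}\cos(\pi x)&-\sin(\pi x)\\ \sin(\pi x)&\cos(\pi x)\end{bmatrix},\qquad x\in[0,1). \] Then the bundle $X\times\mathbb{C}^2$ is reducible under the action of $A$, but $X\times\mathbb{R}^2$ is irreducible under the action of $A$.
   Context: Let $\mathbb{F}$ be $\mathbb{R}$ or $\mathbb{C}$. The cocycle generated by $A(1,\cdot)$ is $A(0,x)=I$, $A(n,x)=A(1,T^{n-1}(x))\cdots A(1,x)$ and $A(-n,x)=A(1,T^{-n}(x))^{-1}\cdots A(1,T^{-1}(x))^{-1}$ for $n>0$. An invariant (measurable) vector bundle in $X\times\mathbb{F}^2$ for $A$ is given by a measurable map $x\mapsto V(x)$ into subspaces of $\mathbb{F}^2$ (measurable with respect to the Grassmannian) for which there is a $T$-invariant set $\tilde X\subset X$ of full measure such that $A(1,x)V(x)=V(T(x))$ for all $x\in\tilde X$. An invariant bundle $V$ is reducible under the action of $A$ if there is an invariant vector bundle $W$ with $\{0\}\subsetneq W(x)\subsetneq V(x)$ for almost every $x$; otherwise it is irreducible. $X\times\mathbb{F}^2$ denotes the trivial bundle $V(x)=\mathbb{F}^2$. *)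

(* Defs.v *)
From HB Require Import structures.
From mathcomp Require Import all_boot all_order all_algebra.
From mathcomp Require Import complex.
From mathcomp Require Import all_classical all_reals all_analysis.
Set Implicit Arguments.
Unset Strict Implicit.
Unset Printing Implicit Defensive.
Import Order.TTheory GRing.Theory Num.Theory.
Import numFieldNormedType.Exports.
Local Open Scope classical_set_scope.
Local Open Scope ring_scope.

Definition circle (R : realType) : Type := {x : R | 0 <= x < 1}.

Definition circle_val (R : realType) (x : circle R) : R := sval x.

Definition frac_part (R : realType) (x : R) : R := x - (Num.floor x)%:~R.

Lemma frac_part_itv (R : realType) (x : R) : 0 <= frac_part x < 1.
Proof.
rewrite /frac_part subr_ge0 ge_floor /= ltrBlDr addrC.
by have := floorD1_gt x; rewrite intrD.
Qed.

Definition to_circle (R : realType) (x : R) : circle R :=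
  exist (fun y : R => 0 <= y < 1) (frac_part x) (frac_part_itv x).

Lemma circle_val_inj (R : realType) : injective (@circle_val R).
Proof. exact: val_inj. Qed.

Lemma circle_valK (R : realType) : cancel (@circle_val R) (@to_circle R).
Proof.
move=> [x x01]; apply: val_inj => /=; rewrite /frac_part /circle_val /=.
by rewrite (@floor_def _ x 0) ?subr0 // add0r.
Qed.

HB.instance Definition _ (R : realType) := Choice.on (circle R).
HB.instance Definition _ (R : realType) :=
  isPointed.Build (circle R) (to_circle 0).

(* The trace of the Borel sigma-algebra of R on [0, 1[, which is also the Borel
   sigma-algebra of the quotient topology of R/Z. *)
HB.instance Definition _ (R : realType) :=
  Measurable.copy (circle R) (g_sigma_algebra_preimageType (@circle_val R)).

Definition circle_lebesgue (R : realType) (A : set (circle R)) : \bar R :=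
  lebesgue_measure (@circle_val R @` A).

Section circle_lebesgue_measure.
Variable R : realType.

Lemma range_circle_val : range (@circle_val R) = `[0, 1[%classic.
Proof.
apply/seteqP; split=> [_ [[x x01] _ <-]|x] /=; rewrite in_itv //= => x01.
by exists (exist (fun y : R => 0 <= y < 1) x x01).
Qed.

Lemma measurable_image_circle_val (A : set (circle R)) :
  measurable A -> measurable (@circle_val R @` A).
Proof.
move=> [B mB <-]; rewrite setTI.
have -> : @circle_val R @` (@circle_val R @^-1` B) = B `&` `[0, 1[%classic.
  rewrite -range_circle_val; apply/seteqP; split=> [_ [x Bx <-]|y [By [x _ xE]]].
    by split=> //; exists x.
  by exists x => //; rewrite /preimage /= xE.
exact: measurableI.
Qed.

Let circle_lebesgue0 : circle_lebesgue (@set0 (circle R)) = 0%E.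
Proof. by rewrite /circle_lebesgue image_set0 measure0. Qed.

Let circle_lebesgue_ge0 (A : set (circle R)) : (0 <= circle_lebesgue A)%E.
Proof. exact: measure_ge0. Qed.

Let circle_lebesgue_sigma_additive :
  semi_sigma_additive (@circle_lebesgue R).
Proof.
move=> F mF tF mUF; rewrite /circle_lebesgue image_bigcup.
apply: measure_semi_sigma_additive.
- by move=> i; exact: measurable_image_circle_val.
- move=> i j _ _ [_ [[x Fix <-] [y Fjy /circle_val_inj yx]]].
  by apply: tF => //; exists x; split=> //; rewrite -yx.
- by rewrite -image_bigcup; exact: measurable_image_circle_val.
Qed.

HB.instance Definition _ := isMeasure.Build _ _ _ (@circle_lebesgue R)
  circle_lebesgue0 circle_lebesgue_ge0 circle_lebesgue_sigma_additive.

Let circle_lebesgueT : circle_lebesgue (@setT (circle R)) = 1%E.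
Proof.
by rewrite /circle_lebesgue range_circle_val lebesgue_measure_itv /= lte01 oppr0 adde0.
Qed.

HB.instance Definition _ := Measure_isProbability.Build _ _ _
  (@circle_lebesgue R) circle_lebesgueT.

End circle_lebesgue_measure.

Section cocycle.
Variables (K : fieldType) (m : nat) (X : Type).
Variables (T Tinv : X -> X) (A1 : X -> 'M[K]_m).

Fixpoint cocycle_pos (n : nat) (x : X) : 'M[K]_m :=
  if n is k.+1 then A1 (iter k T x) *m cocycle_pos k x else 1%:M.

Fixpoint cocycle_neg (n : nat) (x : X) : 'M[K]_m :=
  if n is k.+1 then invmx (A1 (iter k.+1 Tinv x)) *m cocycle_neg k x else 1%:M.

Definition cocycle (n : int) (x : X) : 'M[K]_m :=
  match n with Posz k => cocycle_pos k x | Negz k => cocycle_neg k.+1 x end.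

End cocycle.

Section grassmannian.
Variables (K : numFieldType) (m : nat).

Definition col_space (k : nat) (B : 'M[K]_(m, k)) : {vspace 'cV[K]_m} :=
  limg (linfun (mulmx B)).

(* The Grassmannian of K^m is the disjoint union over k of the spaces of
   k-dimensional subspaces, each with the quotient topology from the k-frames
   (m x k matrices of rank k, an open subset of all m x k matrices). *)
Definition grassmannian_open : set (set {vspace 'cV[K]_m}) :=
  [set U | forall k : nat,
     open [set B : 'M[K]_(m, k) | \rank B = k /\ U (col_space B)]].

Definition grassmannian_borel : set (set {vspace 'cV[K]_m}) :=
  <<s grassmannian_open >>.

End grassmannian.

Section vector_bundles.
Variables (R : realType) (d : measure_display) (X : measurableType d).
Variables (mu : {measure set X -> \bar R}) (T : X -> X).
Variables (K : numFieldType) (m : nat) (A : int -> X -> 'M[K]_m).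
Implicit Types V W : X -> {vspace 'cV[K]_m}.

Definition measurable_bundle V : Prop :=
  forall B, grassmannian_borel B -> measurable (V @^-1` B).

Definition invariant_bundle V : Prop :=
  measurable_bundle V /\
  exists Y : set X, [/\ measurable Y, T @^-1` Y = Y, mu (~` Y) = 0%E &
    forall x, Y x -> (linfun (mulmx (A 1 x)) @: V x)%VS = V (T x)].

Definition trivial_bundle : X -> {vspace 'cV[K]_m} := fun=> fullv.

Definition has_proper_invariant_subbundle V : Prop :=
  exists W, invariant_bundle W /\
    {ae mu, forall x, [/\ W x != 0%VS, (W x <= V x)%VS & W x != V x]}.

Definition reducible V : Prop :=
  invariant_bundle V /\ has_proper_invariant_subbundle V.

Definition irreducible V : Prop :=
  invariant_bundle V /\ ~ has_proper_invariant_subbundle V.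

End vector_bundles.

Arguments trivial_bundle {d} X K m.

Section example.
Variable R : realType.

Definition rotation (eta : R) (x : circle R) : circle R :=
  to_circle (circle_val x + eta).

Lemma rotationK (eta : R) : cancel (rotation eta) (rotation (- eta)).
Proof.
move=> x; rewrite /rotation /= -[RHS]circle_valK; apply: val_inj => /=.
rewrite [in LHS]/circle_val /=  /frac_part.
set f := Num.floor (_ + eta).
have -> : circle_val x + eta - f%:~R - eta = circle_val x + (- f)%:~R.
  by rewrite intrN addrAC addrK.
rewrite floorDrz ?intr_int // [Num.floor (- f)%:~R]intrKfloor intrD.
by rewrite opprD addrACA subrr addr0.
Qed.

Definition half_angle_rotation (x : circle R) : 'M[R]_2 :=
  let t := pi * circle_val x in
  \matrix_(i < 2, j < 2)
    (nth [::] [:: [:: cos t; - sin t];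
                  [:: sin t;   cos t]] i)`_j.

Definition real_cocycle (eta : R) : int -> circle R -> 'M[R]_2 :=
  cocycle (rotation eta) (rotation (- eta)) half_angle_rotation.

Definition complex_cocycle (eta : R) : int -> circle R -> 'M[complex R]_2 :=
  cocycle (rotation eta) (rotation (- eta))
    (fun x => map_mx (real_complex R) (half_angle_rotation x)).

End example.

(* Main.v *)
Require Import Defs.
From mathcomp Require Import all_boot all_order all_algebra perm.
From mathcomp Require Import complex.
From mathcomp Require Import all_classical all_reals all_analysis.
From mathcomp Require Import ring lra.
Set Implicit Arguments.
Unset Strict Implicit.
Unset Printing Implicit Defensive.
Import Order.TTheory GRing.Theory Num.Theory.
Import numFieldNormedType.Exports.
Local Open Scope classical_set_scope.
Local Open Scope ring_scope.

(** Over the complex numbers all plane rotations share the eigenvector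
    (1, -i), so the constant bundle it spans is invariant, and the trivial
    bundle is reducible ([complex_bundle_reducible]).

    Over the reals, a proper nonzero invariant subbundle W is almost everywhere
    a line, of angle theta(x) say, and invariance reads
    2 theta(x + eta) = 2 theta(x) + 2 pi x modulo 2 pi.  Iterating n times,
    2 theta(T^n x) - 2 theta(x) = 2 pi n x + b_n modulo 2 pi, for a constant
    b_n ([birkhoff_sum_mod1], [invariant_line_iter]).  Two facts about this
    angle contradict each other:

    - For every n > 0, the set of x with cos (2 pi n x + b_n) > 0 has measure at
      most 1/2, because the translation by 1/(2n) maps it into its complement
      ([circle_lebesgue_cos_gt0]).

    - For a suitable n > 0, the same set has measure at least 3/4.  Cut the
      circle of doubled angles into the open right, left, upper and lower
      half-circles, and let E_i be the set of x whose line falls in the i-th one;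
      it is measurable as W is.  Dirichlet's theorem provides n > 0 with n eta
      arbitrarily close to an integer ([dirichlet_approximation]), and the
      measure is continuous under translations
      ([circle_translation_continuous]), so outside a set of measure 1/4, x in
      E_i implies T^n x in E_i for all four i.  Then the doubled angles at x
      and at T^n x have a positive scalar product, that is, the cosine of their
      difference is positive ([same_double_coords_cos_gt0]). *)

(** * Rotations of the circle and its Lebesgue measure *)

(** Both sides are measures in A, and they agree on half-open intervals. *)
Lemma lebesgue_measure_shift (R : realType) (t : R) (A : set R) :
  measurable A ->
  lebesgue_measure ((fun x => x + t) @^-1` A) = lebesgue_measure A.
Proof.
move=> mA; pose f (x : measurableTypeR R) : measurableTypeR R := x + t.
have mf : measurable_fun setT f by apply: measurable_realfun.measurable_funD.
rewrite [RHS](@lebesgue_measure_unique _ (pushforward lebesgue_measure f))//.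
move=> _ [[a b] /= ab <-]; rewrite /pushforward.
have -> : f @^-1` `]a, b] = `]a - t, b - t]%classic.
  by apply/seteqP; split=> x /=; rewrite !in_itv /= ltrBlDr lerBrDr.
rewrite !lebesgue_measure_itv /= !lte_fin ltrD2r -!EFinD.
by case: ifP => // _; congr EFin; ring.
Qed.

Lemma frac_partD_int (R : realType) (x : R) (p : int) :
  frac_part (x + p%:~R) = frac_part x.
Proof.
rewrite /frac_part floorDrz ?intr_int // intrKfloor intrD.
by rewrite opprD addrACA subrr addr0.
Qed.

Lemma frac_part_id (R : realType) (x : R) : 0 <= x < 1 -> frac_part x = x.
Proof. by move=> x01; rewrite /frac_part (@floor_def _ x 0) ?subr0 // add0r. Qed.

Lemma frac_part_eq (R : realType) (x : R) :
  exists p : int, frac_part x = x + p%:~R.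
Proof. by exists (- Num.floor x); rewrite intrN. Qed.

Lemma circle_val_itv (R : realType) (x : circle R) : 0 <= circle_val x < 1.
Proof. exact: (svalP x). Qed.

Lemma rotationD (R : realType) (s t : R) (x : circle R) :
  rotation t (rotation s x) = rotation (s + t) x.
Proof.
apply: circle_val_inj; rewrite /rotation /circle_val /= -/(circle_val x).
have [p ->] := frac_part_eq (circle_val x + s).
by rewrite addrAC frac_partD_int addrA.
Qed.

Lemma rotation_int (R : realType) (t : R) (p : int) (x : circle R) :
  rotation (t + p%:~R) x = rotation t x.
Proof.
by apply: circle_val_inj; rewrite /rotation /circle_val /= addrA frac_partD_int.
Qed.

Lemma iter_rotation (R : realType) (t : R) (n : nat) (x : circle R) :
  iter n (rotation t) x = rotation (t *+ n) x.
Proof.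
elim: n => [|n IHn] /=; last by rewrite IHn rotationD -mulrSr.
by rewrite mulr0n /rotation addr0 circle_valK.
Qed.

Lemma measurable_circle_val_preimage (R : realType) (B : set R) :
  measurable B -> measurable (@circle_val R @^-1` B).
Proof. by move=> mB; exists B => //; rewrite setTI. Qed.

(** A rotation of the circle by s acts on [0, 1[ as an exchange of the two
    intervals [0, 1 - s[ and [1 - s, 1[, on each of which it is a translation. *)
Lemma image_circle_val_rotation (R : realType) (t : R) (A : set (circle R)) :
  let s := frac_part t in let B := @circle_val R @` A in
  @circle_val R @` (rotation t @^-1` A) =
    ((fun y => y + s) @^-1` (B `&` `[s, 1[)) `|`
    ((fun y => y + (s - 1)) @^-1` (B `&` `[0, s[)).
Proof.
move=> s B; have /andP[s0 s1] : 0 <= s < 1 by exact: frac_part_itv.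
have rotE x : circle_val (rotation t x) = frac_part (circle_val x + s).
  rewrite /rotation /circle_val /= /s; have [p ->] := frac_part_eq t.
  by rewrite addrA frac_partD_int.
clearbody s; apply/seteqP; split => [_ [x Ax <-]|y].
  have /andP[x0 x1] := circle_val_itv x.
  have Bx : B (frac_part (circle_val x + s)) by exists (rotation t x).
  have [xs|xs] := ltP (circle_val x + s) 1; [left|right] => /=.
    rewrite frac_part_id in Bx; last by rewrite addr_ge0.
    by split=> //=; rewrite in_itv /= xs lerDr x0.
  rewrite -(frac_partD_int _ (-1)) frac_part_id -?addrA in Bx; last first.
    by rewrite mulrN1z; lra.
  by rewrite mulrN1z in Bx; split=> //=; rewrite in_itv /=; lra.
case=> -[[x Ax xE]] /=; rewrite in_itv /= => /andP[y1 y2].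
  have y01 : 0 <= y < 1 by lra.
  exists (exist (fun y : R => 0 <= y < 1) y y01) => //=.
  rewrite -[rotation _ _](_ : x = _)//; apply: circle_val_inj.
  by rewrite rotE xE frac_part_id// /circle_val /=; lra.
have y01 : 0 <= y < 1 by lra.
exists (exist (fun y : R => 0 <= y < 1) y y01) => //=.
rewrite -[rotation _ _](_ : x = _)//; apply: circle_val_inj.
rewrite rotE xE -[RHS](frac_partD_int _ (-1)) frac_part_id /circle_val /=.
  by rewrite mulrN1z addrA.
by rewrite mulrN1z; lra.
Qed.

Lemma measurable_shift_preimage (R : realType) (t : R) (B : set R) :
  measurable B -> measurable ((fun y : R => y + t) @^-1` B).
Proof.
move=> mB; rewrite -[X in measurable X]setTI.
have mf : measurable_fun setT (fun y : R => y + t).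
  by apply: measurable_realfun.measurable_funD.
exact: mf.
Qed.

Lemma measurable_rotation_preimage (R : realType) (t : R) (A : set (circle R)) :
  measurable A -> measurable (rotation t @^-1` A).
Proof.
move=> mA.
have -> : rotation t @^-1` A =
    @circle_val R @^-1` (@circle_val R @` (rotation t @^-1` A)).
  apply/seteqP; split => [x Ax|x [y Ay /circle_val_inj <-//]].
  by exists x.
apply: measurable_circle_val_preimage; rewrite image_circle_val_rotation.
by apply: measurableU; apply: measurable_shift_preimage; apply: measurableI => //;
   apply: measurable_image_circle_val.
Qed.

(** By [image_circle_val_rotation] the rotation is a piecewise translation, so
    its invariance reduces to that of the Lebesgue measure on the line. *)
Lemma circle_lebesgue_rotation (R : realType) (t : R) (A : set (circle R)) :
  measurable A -> circle_lebesgue (rotation t @^-1` A) = circle_lebesgue A.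
Proof.
move=> mA; rewrite /circle_lebesgue image_circle_val_rotation /=.
set s := frac_part t; set B := _ @` A.
have /andP[s0 s1] : 0 <= s < 1 by exact: frac_part_itv.
have mB : measurable B by exact: measurable_image_circle_val.
have mB1 : measurable (B `&` `[s, 1[) by apply: measurableI.
have mB2 : measurable (B `&` `[0, s[) by apply: measurableI.
rewrite measureU; last 3 first.
- exact: measurable_shift_preimage.
- exact: measurable_shift_preimage.
- apply/seteqP; split=> y //= [[_]]/[swap] -[_] /=; rewrite !in_itv /=; lra.
transitivity (lebesgue_measure (B `&` `[s, 1%R[) + lebesgue_measure (B `&` `[0%R, s[))%E.
  by congr (_ + _)%E; exact: lebesgue_measure_shift.
rewrite -measureU//; last first.
  apply/seteqP; split=> y //= [[_]]/[swap] -[_] /=; rewrite !in_itv /=; lra.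
congr (lebesgue_measure _); rewrite -setIUr; apply/seteqP; split=> [y []//|y By].
split=> //; have [x _ xy] := By; have := circle_val_itv x; rewrite xy => y01.
by have [ys|ys] := ltP y s; [right|left] => /=; rewrite in_itv /=; lra.
Qed.

(** * Recurrence and oscillation on the circle *)

Lemma circle_lebesgue_preimage_le (R : realType) (B : set R) :
  measurable B ->
  (circle_lebesgue (@circle_val R @^-1` B) <= lebesgue_measure B)%E.
Proof.
move=> mB; rewrite /circle_lebesgue; apply: le_measure; rewrite ?inE//.
  by apply: measurable_image_circle_val; exact: measurable_circle_val_preimage.
by move=> _ [x Bx <-].
Qed.

Lemma compact_translate_near (R : realType) (V U : set R) :
  compact V -> open U -> V `<=` U ->
  \forall t \near (0 : R^o), forall x, V x -> U (x + t).
Proof.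
move=> /compact_near_coveringP cV oU VU.
apply: (cV R^o (nbhs (0 : R^o)) (fun t x => U (x + t)) _) => x Vx.
have Ux : nbhs (x + 0) U.
  by rewrite addr0; apply: open_nbhs_nbhs; split=> //; exact: VU.
exact: (@add_continuous R^o (x, 0) U Ux).
Qed.

(** Sandwich A between a compact V and an open U with U - V of measure at most
    e.  As a small translation keeps V inside U, a point of A can leave A only
    by lying in A - V or by landing in U - A.  Everything is cut down to the
    open interval ]0, 1[, on which a small rotation that stays inside does not
    wrap around and is thus an ordinary translation. *)
Lemma circle_translation_continuous (R : realType) (A : set (circle R))
    (e : R) :
  measurable A -> 0 < e ->
  \forall t \near (0 : R^o),
    (circle_lebesgue (A `\` (rotation t @^-1` A)) <= e%:E)%E.
Proof.
move=> mA e0; pose B := @circle_val R @` A `&` `]0, 1[.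
have mB : measurable B.
  by apply: measurableI => //; exact: measurable_image_circle_val.
have Boo : (lebesgue_measure B < +oo)%E.
  apply: (@le_lt_trans _ _ (lebesgue_measure (`]0, 1[%classic : set R))).
    by apply: le_measure; rewrite ?inE// => x [].
  by rewrite lebesgue_measure_itv /= lte_fin ltr01 -EFinD ltry.
have e20 : 0 < e / 2 by rewrite divr_gt0.
have [V [cV VB mVB]] := lebesgue_regularity_inner mB Boo e20.
have [U [oU BU mUB]] := lebesgue_regularity_outer mB Boo e20.
have mV : measurable V.
  apply: (@measurable_realfun.closed_measurable R).
  exact: (compact_closed (@Rhausdorff R) cV).
have mU : measurable U by apply: measurable_realfun.open_measurable.
have VU : V `<=` U `&` `]0, 1[ by move=> x /VB [Bx x01]; split=> //; apply: BU.
have oU01 : open (U `&` `]0, 1[) by apply: openI => //; exact: interval_open.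
apply: filterS (compact_translate_near cV oU01 VU) => t tVU.
(* The point 0 is lost when A is cut down to ]0, 1[. *)
pose C0 := @circle_val R @^-1` [set 0].
pose C1 := @circle_val R @^-1` (B `\` V).
pose C2 := rotation t @^-1` (@circle_val R @^-1` (U `\` B)).
have mC0 : measurable C0 by exact: measurable_circle_val_preimage.
have mC1 : measurable C1.
  by apply: measurable_circle_val_preimage; exact: measurableD.
have mC2' : measurable (@circle_val R @^-1` (U `\` B)).
  by apply: measurable_circle_val_preimage; exact: measurableD.
have mC2 : measurable C2 by exact: measurable_rotation_preimage.
have sub : A `\` (rotation t @^-1` A) `<=` C0 `|` (C1 `|` C2).
  move=> x [Ax nAx]; have /andP[x0 x1] := circle_val_itv x.
  have [x00|xn0] := eqVneq (circle_val x) 0; first by left.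
  right; have Bx : B (circle_val x).
    split; first by exists x.
    by rewrite /= in_itv /= x1 lt_neqAle eq_sym xn0 x0.
  have [Vx|nVx] := pselect (V (circle_val x)); last by left; split.
  right; have [Ux] := tVU _ Vx; rewrite /= in_itv /= => /andP[xt0 xt1].
  have rE : circle_val (rotation t x) = circle_val x + t.
    rewrite /rotation /circle_val /= -/(circle_val x) frac_part_id//.
    by rewrite (ltW xt0).
  suff : (U `\` B) (circle_val (rotation t x)) by [].
  rewrite rE; split=> // -[[y Ay yE] _].
  have yx : y = rotation t x by apply: circle_val_inj; rewrite rE.
  by apply: nAx; move: Ay; rewrite yx.
have mA' : measurable (A `\` (rotation t @^-1` A)).
  by apply: measurableD => //; exact: measurable_rotation_preimage.
apply: (@le_trans _ _ (circle_lebesgue (C0 `|` (C1 `|` C2)))).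
  by apply: le_measure; rewrite ?inE//; do ?apply: measurableU.
apply: (@le_trans _ _ (circle_lebesgue C0 +
  (circle_lebesgue C1 + circle_lebesgue C2))%E).
  apply: (le_trans (measureU2 _ _ _)) => //; first exact: measurableU.
  by apply: leeD => //; exact: measureU2.
have -> : circle_lebesgue C0 = 0%E.
  apply/eqP; rewrite eq_le measure_ge0 andbT.
  rewrite -[leRHS](@lebesgue_measure_set1 _ 0).
  exact: circle_lebesgue_preimage_le.
rewrite add0e (splitr e) EFinD; apply: leeD.
  apply: (le_trans _ (ltW mVB)); apply: circle_lebesgue_preimage_le.
  exact: measurableD.
rewrite circle_lebesgue_rotation//.
apply: (le_trans _ (ltW mUB)); apply: circle_lebesgue_preimage_le.
exact: measurableD.
Qed.

(** Pigeonhole: two of the N + 1 fractional parts of i * eta, for i <= N, lie in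
    the same interval of length 1 / N. *)
Lemma dirichlet_approximation (R : realType) (eta delta : R) : 0 < delta ->
  exists n (p : int), (0 < n)%N /\ `|eta *+ n + p%:~R| < delta.
Proof.
move=> d0; pose N := (Num.truncn delta^-1).+1.
have N0 : 0 < N%:R :> R by rewrite ltr0n.
have dN : delta^-1 < N%:R.
  by have /andP[] := truncn_itv (ltW (etrans (invr_gt0 delta) d0)).
pose f (i : nat) := Num.truncn (N%:R * frac_part (eta *+ i)).
have fP i : (f i)%:R <= N%:R * frac_part (eta *+ i) < (f i).+1%:R.
  have /andP[fi _] := frac_part_itv (eta *+ i).
  by apply: truncn_itv; apply: mulr_ge0 => //; exact: ltW.
have fN i : (f i < N)%N.
  rewrite -(ltr_nat R); have /andP[fi _] := fP i; apply: (le_lt_trans fi).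
  by rewrite gtr_pMr//; have /andP[] := frac_part_itv (eta *+ i).
pose g (i : 'I_N.+1) : 'I_N := Ordinal (fN i).
have /injectivePn[i [j ij gij]] : ~~ injectiveb g.
  by apply/injectiveP => /leq_card; rewrite !card_ord ltnn.
wlog lij : i j ij gij / (i < j)%N.
  move=> H; have [lij|lji|eij] := ltngtP i j; first exact: (H i j).
    by apply: (H j i) => //; rewrite eq_sym.
  by move/eqP: ij; case; apply: val_inj.
have fij : f i = f j by move/(congr1 val): gij.
have [p pE] := frac_part_eq (eta *+ i); have [q qE] := frac_part_eq (eta *+ j).
exists (j - i)%N, (q - p); split; first by rewrite subn_gt0.
have -> : eta *+ (j - i) + (q - p)%:~R =
    frac_part (eta *+ j) - frac_part (eta *+ i).
  by rewrite pE qE mulrnBr 1?ltnW// intrB; ring.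
have := fP i; have := fP j; rewrite -fij -natr1 => /andP[j1 j2] /andP[i1 i2].
rewrite -(ltr_pM2l N0) -[N%:R in ltLHS]gtr0_norm// -normrM mulrBr.
apply: (@lt_trans _ _ 1); first by rewrite ltr_norml; lra.
by rewrite -ltr_pdivrMr// div1r.
Qed.

Lemma cosD2pi_int (R : realType) (a : R) (p : int) :
  cos (a + pi *+ 2 * p%:~R) = cos a.
Proof.
case: p => n; rewrite ?NegzE ?intrN -[(Posz _)%:~R]/(_%:R) ?mulrN mulr_natr.
  exact: (periodicn (@cosD2pi R)).
by rewrite -[LHS](periodicn (@cosD2pi R) n.+1) subrK.
Qed.

(** The translation by 1 / (2n) adds pi to the argument, so it changes the sign
    of the cosine: G is disjoint from a translate of itself. *)
Lemma circle_lebesgue_cos_gt0 (R : realType) (n : nat) (b : R) : (0 < n)%N ->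
  let G := [set x : circle R | 0 < cos (pi *+ 2 * (circle_val x *+ n) + b)] in
  measurable G /\ (circle_lebesgue G <= (2^-1)%:E)%E.
Proof.
move=> n0 G; pose f (y : R^o) : R^o := cos (pi *+ 2 * (y *+ n) + b).
have cf : continuous f.
  move=> y; rewrite /f; apply: (@continuous_comp _ _ _
    (fun y : R^o => pi *+ 2 * (y *+ n) + b : R^o) (@cos R));
    last exact: continuous_cos.
  apply: (@continuousD _ R^o); last exact: cst_continuous.
  apply: (@continuousM R); first exact: cst_continuous.
  exact: natmul_continuous.
have mG : measurable G.
  have -> : G = @circle_val R @^-1` (f @^-1` `]0, +oo[).
    by apply/seteqP; split=> x; rewrite /G /preimage /= in_itv /= andbT.
  apply: measurable_circle_val_preimage; apply: measurable_realfun.open_measurable.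
  by apply: open_comp => //; exact: interval_open.
split=> //; pose s : R := (n%:R *+ 2)^-1.
have ns : s *+ n = 2^-1.
  by rewrite -mulr_natr /s -mulr_natr; field; rewrite pnatr_eq0 -lt0n n0.
have dis : G `&` (rotation s @^-1` G) = set0.
  apply/seteqP; split=> x // -[Gx Gsx].
  have [p pE] := frac_part_eq (circle_val x + s).
  have vE : circle_val (rotation s x) = circle_val x + s + p%:~R by [].
  have : 0 < cos (pi *+ 2 * (circle_val (rotation s x) *+ n) + b) by [].
  rewrite vE.
  rewrite (_ : _ + b = (pi *+ 2 * (circle_val x *+ n) + b + pi) +
     pi *+ 2 * (p *+ n)%:~R); last first.
    by rewrite !(mulrnDl n) ns rmorphMn /=; move: (@pi R) => q; field.
  by rewrite cosD2pi_int cosDpi; move: Gx; rewrite /G /=; lra.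
have mG' : measurable (rotation s @^-1` G) by exact: measurable_rotation_preimage.
have : (circle_lebesgue G + circle_lebesgue G <= 1)%E.
  rewrite -{2}(circle_lebesgue_rotation s mG) -measureU//.
  exact: probability_le1 (measurableU _ _ mG mG').
have fG : circle_lebesgue G \is a fin_num by exact: fin_num_measure.
rewrite -(fineK fG) -EFinD !lee_fin; lra.
Qed.

(** * Open sets in the Grassmannian *)

Lemma continuous_matrix (T : topologicalType) (K : numFieldType) (m n : nat)
    (f : T -> 'M[K]_(m, n)) :
  (forall i j, continuous (fun x => f x i j)) -> continuous f.
Proof.
move=> cf x A [P Pf PA].
have : \forall y \near x, forall i j, P i j (f y i j).
  by apply: filter_forall => i; apply: filter_forall => j; exact: cf (Pf i j).
by apply: filterS => y Py; exact: PA.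
Qed.

Lemma continuous_mulmx (T : topologicalType) (K : numFieldType) (m n p : nat)
    (f : T -> 'M[K]_(m, n)) (g : T -> 'M[K]_(n, p)) :
  continuous f -> continuous g -> continuous (fun x => f x *m g x).
Proof.
move=> cf cg; apply: continuous_matrix => i j.
under eq_fun do rewrite mxE.
apply: continuous_big => [|k _]; first exact: (@add_continuous K^o).
move=> x; apply: (@continuousM K).
  exact: (continuous_comp (cf x) (@coord_continuous K _ _ i k (f x))).
exact: (continuous_comp (cg x) (@coord_continuous K _ _ k j (g x))).
Qed.

Lemma continuous_determinant (K : numFieldType) (n : nat) :
  continuous (fun B : 'M[K]_n => \det B).
Proof.
apply: continuous_big => [|s _]; first exact: (@add_continuous K^o).
move=> B; apply: (@continuousM K 'M[K]_n (cst ((-1) ^+ s))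
  (fun B : 'M[K]_n => \prod_i B i (s i))); first exact: cst_continuous.
move: B; apply: continuous_big => [|i _]; first exact: mul_continuous.
exact: coord_continuous.
Qed.

Lemma memv_col_space (K : numFieldType) (m k : nat) (B : 'M[K]_(m, k)) v :
  v \in col_space B <-> exists u, v = B *m u.
Proof.
split=> [/memv_imgP[u _ ->]|[u ->]]; first by exists u; rewrite lfunE.
by rewrite -[B *m u](lfunE (mulmx B)) memv_img// memvf.
Qed.

(** The column space of B meets O iff B u lies in O for some u, an open
    condition on B for each fixed u; having full rank is open too, being the
    existence of C with det (C B) nonzero. *)
Lemma grassmannian_open_meet (K : numFieldType) (m : nat) (O : set 'cV[K]_m) :
  open O -> grassmannian_open [set W : {vspace 'cV[K]_m} | exists2 v, v \in W & O v].
Proof.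
move=> oO k.
pose S (p : 'M[K]_(k, m) * 'cV[K]_k) :=
  [set B : 'M[K]_(m, k) | \det (p.1 *m B) != 0 /\ O (B *m p.2)].
rewrite [X in open X](_ : _ = \bigcup_p S p).
  apply: bigcup_open => -[C u] _; apply: openI.
    rewrite [X in open X](_ : _ = (fun B : 'M[K]_(m, k) => \det (C *m B))
        @^-1` (~` [set 0])); last first.
      by apply/seteqP; split=> B /= /eqP.
    apply: open_comp.
      move=> B _; apply: continuous_comp.
        by apply: continuous_mulmx => ?; [exact: cst_continuous|exact: cvg_id].
      exact: continuous_determinant.
    rewrite openC; apply: accessible_closed_set1; apply: hausdorff_accessible.
    exact: (@norm_hausdorff K K^o).
  rewrite [X in open X](_ : _ = (fun B : 'M[K]_(m, k) => B *m u) @^-1` O)//.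
  apply: open_comp => // B _.
  by apply: continuous_mulmx => ?; [exact: cvg_id|exact: cst_continuous].
apply/seteqP; split=> [B [rB [v /memv_col_space[u ->] Ou]]|B [[C u] _ [/= dB Ou]]].
  have /row_fullP[C CB] : row_full B by rewrite /row_full rB.
  by exists (C, u) => //; split=> //=; rewrite CB det1 oner_neq0.
split; last by exists (B *m u) => //; apply/memv_col_space; exists u.
apply/eqP; rewrite -/(row_full B); apply/row_fullP.
exists (invmx (C *m B) *m C); rewrite -mulmxA mulVmx//.
by rewrite unitmxE unitfE.
Qed.

(** * Invariant bundles and subspaces of the plane *)

Section bundles.
Context (R : realType) (d : measure_display) (X : measurableType d).
Context (mu : {measure set X -> \bar R}) (T : X -> X).
Context (K : numFieldType) (m : nat) (A : int -> X -> 'M[K]_m).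

Lemma constant_bundle_invariant (V : {vspace 'cV[K]_m}) :
  (forall x, (linfun (mulmx (A 1 x)) @: V)%VS = V) ->
  invariant_bundle mu T A (fun=> V).
Proof.
move=> AV; split.
  move=> B _; have [BV|nBV] := pselect (B V).
    by rewrite (_ : _ @^-1` _ = setT)//; apply/seteqP; split.
  by rewrite (_ : _ @^-1` _ = set0)//; apply/seteqP; split.
by exists setT; split => //; rewrite setCT measure0.
Qed.

Lemma trivial_bundle_invariant :
  (forall x, A 1 x \in unitmx) -> invariant_bundle mu T A (trivial_bundle X K m).
Proof.
move=> uA; apply: constant_bundle_invariant => x.
apply/eqP; rewrite eqEsubv subvf; apply/subvP => v _.
by rewrite -[v](mulKVmx (uA x)) -[_ *m _]lfunE memv_img// memvf.
Qed.

End bundles.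

Lemma vspace_line (K : fieldType) (V : {vspace 'cV[K]_2}) :
  V != 0%VS -> V != fullv -> exists2 v, v != 0 & V = <[v]>%VS.
Proof.
move=> V0 V1; exists (vpick V); first by rewrite vpick0.
apply/eqP; rewrite eq_sym eqEdim -memvE memv_pick dim_vline vpick0 V0.
have := subvf V => /dimv_leqif_eq/ltn_leqif; rewrite V1 dimvf.
by rewrite /dim /= ltnS.
Qed.

(** * Plane rotations and the two cocycles *)

(** The generator of the cocycle at x is the rotation by pi * x; arbitrary angles
    are needed for its iterates. *)
Definition rotation_matrix (R : realType) (t : R) : 'M[R]_2 :=
  \matrix_(i < 2, j < 2)
    (nth [::] [:: [:: cos t; - sin t];
                  [:: sin t;   cos t]] i)`_j.

Lemma rotation_matrixD (R : realType) (s t : R) :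
  rotation_matrix s *m rotation_matrix t = rotation_matrix (s + t).
Proof.
apply/matrixP => i j; rewrite !mxE !big_ord_recl big_ord0 !mxE /= cosD sinD.
by case: i j => [[|[|//]] ?] [[|[|//]] ?] /=; ring.
Qed.

Lemma rotation_matrix0 (R : realType) : rotation_matrix (0 : R) = 1%:M.
Proof.
apply/matrixP => i j; rewrite !mxE cos0 sin0 oppr0.
by case: i j => [[|[|//]] ?] [[|[|//]] ?].
Qed.

Lemma rotation_matrix_unit (R : realType) (t : R) : rotation_matrix t \in unitmx.
Proof.
have [|] := @mulmx1_unit _ _ (rotation_matrix t) (rotation_matrix (- t)) => //.
by rewrite rotation_matrixD subrr rotation_matrix0.
Qed.

Lemma real_cocycle1 (R : realType) (eta : R) (x : circle R) :
  real_cocycle eta 1 x = rotation_matrix (pi * circle_val x).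
Proof. by rewrite /real_cocycle /= mulmx1. Qed.

Lemma complex_cocycle1 (R : realType) (eta : R) (x : circle R) :
  complex_cocycle eta 1 x =
    map_mx (real_complex R) (rotation_matrix (pi * circle_val x)).
Proof. by rewrite /complex_cocycle /= mulmx1. Qed.

(** Rotations preserve the form x^2 + y^2 and its two isotropic lines over the
    complex numbers; this vector spans one of them. *)
Definition isotropic_vector (R : realType) : 'cV[complex R]_2 :=
  \col_(i < 2) [:: 1; - 'i%C]`_i.

Lemma isotropic_vector_eigen (R : realType) (t : R) :
  map_mx (real_complex R) (rotation_matrix t) *m isotropic_vector R =
    (cos t +i* sin t)%C *: isotropic_vector R.
Proof.
apply/matrixP => i j; rewrite !mxE !big_ord_recl big_ord0 !mxE /=.
case: i => [[|[|//]] ?] /=; apply/eqP; rewrite eq_complex /=;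
  by apply/andP; split; apply/eqP; ring.
Qed.

Lemma complex_bundle_reducible (R : realType) (eta : R) :
  reducible (@circle_lebesgue R) (rotation eta) (complex_cocycle eta)
    (trivial_bundle (circle R) (complex R) 2).
Proof.
split.
  apply: trivial_bundle_invariant => x.
  by rewrite complex_cocycle1 map_unitmx rotation_matrix_unit.
have v0 : isotropic_vector R != 0.
  apply/eqP => /matrixP/(_ ord0 ord0); rewrite !mxE /= => /eqP.
  by rewrite oner_eq0.
exists (fun=> <[isotropic_vector R]>%VS); split.
  apply: constant_bundle_invariant => x.
  rewrite complex_cocycle1 limg_line lfunE /= isotropic_vector_eigen.
  set t := pi * _; set c := (_ +i* _)%C.
  have c0 : c != 0.
    apply/eqP => -[ct st]; have := cos2Dsin2 t.
    by rewrite ct st expr0n addr0 => /eqP; rewrite eq_sym oner_eq0.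
  apply/eqP; rewrite eqEdim !dim_vline scaler_eq0 negb_or c0 v0 andbT.
  by rewrite -memvE memvZ// memv_line.
apply: aeW => x; split; last 1 first.
- apply/negP => /eqP/(congr1 (fun V : {vspace _} => \dim V)).
  by rewrite dim_vline v0 dimvf.
- by rewrite -dimv_eq0 dim_vline v0.
- exact: subvf.
Qed.

(** * Doubled angles *)

(** For v of polar coordinates (r, theta), this is r^2 cos (2 theta), and
    [double_sin] is r^2 sin (2 theta).  They depend on the line spanned by v only
    up to a positive factor. *)
Definition double_cos (R : realType) (v : 'cV[R]_2) : R :=
  v 0 0 ^+ 2 - v 1 0 ^+ 2.
Definition double_sin (R : realType) (v : 'cV[R]_2) : R :=
  2 * v 0 0 * v 1 0.

(** The four quadratic forms whose positivity says that the doubled angle of v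
    lies in the open right, left, upper or lower half-circle. *)
Definition double_coord (R : realType) (i : bool * bool) (v : 'cV[R]_2) : R :=
  (-1) ^+ i.1 * (if i.2 then double_cos v else double_sin v).

Lemma rotation_double_angle (R : realType) (t : R) (v : 'cV[R]_2) :
  let w := rotation_matrix t *m v in
  double_cos w = cos (t *+ 2) * double_cos v - sin (t *+ 2) * double_sin v /\
  double_sin w = sin (t *+ 2) * double_cos v + cos (t *+ 2) * double_sin v.
Proof.
rewrite /double_cos /double_sin !mxE !big_ord_recl !big_ord0 !mxE /=.
rewrite (_ : lift ord0 ord0 = 1)//; last exact: val_inj.
by rewrite mulr2n cosD sinD; split; ring.
Qed.

Lemma double_angle_neq0 (R : realType) (v : 'cV[R]_2) : v != 0 ->
  0 < double_cos v ^+ 2 + double_sin v ^+ 2.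
Proof.
move=> v0; rewrite [ltRHS](_ : _ = (v 0 0 ^+ 2 + v 1 0 ^+ 2) ^+ 2); last first.
  by rewrite /double_cos /double_sin; ring.
rewrite exprn_gt0// lt_neqAle addr_ge0 ?sqr_ge0// andbT eq_sym.
rewrite paddr_eq0 ?sqr_ge0// !sqrf_eq0; apply: contra_neqN v0 => /andP[/eqP v0 /eqP v1].
apply/matrixP => i j; rewrite mxE ord1.
case: i => [[|[|//]] i2]; first by rewrite -[RHS]v0; congr (v _ _); exact: val_inj.
by rewrite -[RHS]v1; congr (v _ _); exact: val_inj.
Qed.

(** Applied to corresponding coordinates of two vectors.  A doubled vector on
    one axis has a zero coordinate, and the sign of that coordinate after the
    rotation is then unknown: the product vanishes whatever it is. *)
Lemma mulr_ge0_same_sign (R : realType) (x y : R) :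
  (0 < x -> 0 < y) -> (x < 0 -> y < 0) -> 0 <= x * y /\ (x * y = 0 -> x = 0).
Proof.
move=> xy_gt0 xy_lt0; have [x0|x0|->] := ltgtP x 0; last by rewrite mul0r.
  have xy := nmulr_rgt0 y x0; rewrite (xy_lt0 x0) in xy.
  by rewrite (ltW xy); split=> // xy0; rewrite xy0 ltxx in xy.
have xy := pmulr_rgt0 y x0; rewrite (xy_gt0 x0) in xy.
by rewrite (ltW xy); split=> // xy0; rewrite xy0 ltxx in xy.
Qed.

(** Each coordinate of the doubled vector of the rotated v has the sign of
    the corresponding coordinate for v, unless the latter vanishes.  Their scalar
    product, which is cos (2 t) times the squared norm, is therefore positive. *)
Lemma same_double_coords_cos_gt0 (R : realType) (t : R) (v : 'cV[R]_2) : v != 0 ->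
  (forall i, 0 < double_coord i v -> 0 < double_coord i (rotation_matrix t *m v)) ->
  0 < cos (t *+ 2).
Proof.
move=> /double_angle_neq0 v0 h.
have := h (false, true); have := h (true, true).
have := h (false, false); have := h (true, false).
rewrite /double_coord /= expr0 expr1 !mul1r !mulN1r !oppr_gt0.
have [-> ->] := rotation_double_angle t v.
move: v0; set a := double_cos v; set b := double_sin v.
move: (cos _) (sin _) => c s.
move=> v0 b_lt0 b_gt0 a_lt0 a_gt0.
have [aa a0] := mulr_ge0_same_sign a_gt0 a_lt0.
have [bb b0] := mulr_ge0_same_sign b_gt0 b_lt0.
have E : a * (c * a - s * b) + b * (s * a + c * b) = c * (a ^+ 2 + b ^+ 2) by ring.
have : 0 <= c * (a ^+ 2 + b ^+ 2) by rewrite -E addr_ge0.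
rewrite pmulr_lge0// le_eqVlt => /predU1P[c0|//].
have : a * (c * a - s * b) + b * (s * a + c * b) == 0 by rewrite E -c0 mul0r.
rewrite paddr_eq0// => /andP[/eqP/a0 a00 /eqP/b0 b00].
by move: v0; rewrite a00 b00 !expr0n addr0 ltxx.
Qed.

Lemma continuous_double_coord (R : realType) (i : bool * bool) :
  continuous (@double_coord R i).
Proof.
have c0 : continuous (fun v : 'cV[R]_2 => v 0 0) by exact: coord_continuous.
have c1 : continuous (fun v : 'cV[R]_2 => v 1 0) by exact: coord_continuous.
case: i => s [] v; apply: (@continuousM R 'cV[R]_2 (cst _)); try exact: cst_continuous.
  apply: (@continuousB R R^o 'cV[R]_2 (fun v => v 0 0 ^+ 2) (fun v => v 1 0 ^+ 2)).
    exact: (continuousM (c0 v) (c0 v)).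
  exact: (continuousM (c1 v) (c1 v)).
apply: continuousM (c1 v); apply: continuousM (c0 v).
exact: cst_continuous.
Qed.

Lemma double_coordZ (R : realType) i (k : R) v :
  double_coord i (k *: v) = k ^+ 2 * double_coord i v.
Proof.
rewrite /double_coord /double_cos /double_sin !mxE; case: i.2; ring.
Qed.

(** The forms are quadratic, so their sign is constant on a line minus 0, and
    the sets of lines on which they are positive are traces of open sets of
    subspaces as in [grassmannian_open_meet]. *)
Lemma double_coord_line (R : realType) i (v : 'cV[R]_2) :
  (exists2 u, u \in <[v]>%VS & 0 < double_coord i u) <-> 0 < double_coord i v.
Proof.
split=> [[_ /vlineP[k ->]]|v0]; last by exists v => //; exact: memv_line.
rewrite double_coordZ => kv; apply: contraTT kv; rewrite -!leNgt => v0.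
by rewrite mulr_ge0_le0// sqr_ge0.
Qed.

(** * Invariant line bundles of the real cocycle *)

Definition birkhoff_sum (R : realType) (eta : R) (n : nat) (x : circle R) : R :=
  \sum_(k < n) circle_val (iter k (rotation eta) x).

(** The k-th term is x + k * eta modulo 1, and the multiples of eta add up to
    n (n - 1) / 2. *)
Lemma birkhoff_sum_mod1 (R : realType) (eta : R) (n : nat) (x : circle R) :
  exists p : int,
  birkhoff_sum eta n x = circle_val x *+ n + eta *+ 'C(n, 2) + p%:~R.
Proof.
elim: n => [|n [p IHn]].
  by exists 0; rewrite /birkhoff_sum big_ord0 mulr0n !addr0.
have [q qE] := frac_part_eq (circle_val x + eta *+ n).
exists (p + q); rewrite /birkhoff_sum big_ord_recr -/(birkhoff_sum eta n x) IHn.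
rewrite iter_rotation [circle_val (rotation _ _)]qE intrD.
by rewrite binS bin1 mulrnDr (mulrSr (circle_val x)) /=; ring.
Qed.

Lemma invariant_line_iter (R : realType) (eta : R)
    (W : circle R -> {vspace 'cV[R]_2}) (Y : set (circle R)) (x : circle R)
    (v : 'cV[R]_2) (n : nat) :
  rotation eta @^-1` Y = Y ->
  (forall x, Y x ->
     (linfun (mulmx (real_cocycle eta 1 x)) @: W x)%VS = W (rotation eta x)) ->
  Y x -> W x = <[v]>%VS ->
  W (iter n (rotation eta) x) =
    <[rotation_matrix (pi * birkhoff_sum eta n x) *m v]>%VS.
Proof.
move=> TY AW Yx Wx; elim: n => [|n IHn].
  by rewrite /birkhoff_sum big_ord0 mulr0 rotation_matrix0 mul1mx.
have Yn : Y (iter n (rotation eta) x) by elim: n {IHn} => //= n; rewrite -{1}TY.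
rewrite iterS -AW// IHn limg_line real_cocycle1 lfunE /= mulmxA rotation_matrixD.
by rewrite -mulrDr addrC /birkhoff_sum big_ord_recr.
Qed.

Lemma real_bundle_irreducible (R : realType) (eta : R) :
  irreducible (@circle_lebesgue R) (rotation eta) (real_cocycle eta)
    (trivial_bundle (circle R) R 2).
Proof.
split.
  apply: trivial_bundle_invariant => x.
  by rewrite real_cocycle1 rotation_matrix_unit.
move=> [W [[mW [Y [mY TY muY AW]]] [N [mN muN WN]]]].
(* E i: the points whose line has its doubled angle in the i-th half-circle. *)
pose E i := W @^-1`
  [set V : {vspace 'cV[R]_2} | exists2 v, v \in V & 0 < double_coord i v].
have mE i : measurable (E i).
  apply: mW; apply: sub_sigma_algebra.
  apply: (@grassmannian_open_meet R 2 (double_coord i @^-1` [set r | 0 < r])).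
  apply: open_comp; last exact: open_gt.
  by move=> v _; exact: continuous_double_coord.
have Enear (i : bool * bool) : \forall t \near (0 : R^o),
    (circle_lebesgue (E i `\` (rotation t @^-1` (E i))) <= (16^-1)%:E)%E.
  exact: circle_translation_continuous.
have [d /= d0 dE] := iffLR (nbhs_ballP _ _) (filter_forall _ Enear).
have [n [p [n0 npd]]] := dirichlet_approximation eta d0.
(* The points that leave E i under T^n, a set of measure at most 1/16. *)
pose D i := E i `\` (rotation (eta *+ n) @^-1` (E i)).
have mD i : measurable (D i).
  by apply: measurableD => //; exact: measurable_rotation_preimage.
have muD i : (circle_lebesgue (D i) <= (16^-1)%:E)%E.
  rewrite /D (_ : rotation _ = rotation (eta *+ n + p%:~R)); last first.
    by apply/funext => x; rewrite rotation_int.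
  by apply: dE; rewrite /ball /= sub0r normrN.
pose b := pi *+ 2 * (eta *+ 'C(n, 2)).
have [mG muG] := circle_lebesgue_cos_gt0 b n0.
set G := [set x | _] in mG muG.
(* Off F, W is an invariant line along the orbit, and no E i is left under T^n. *)
pose F := (~` Y `|` N) `|` ((D (false, false) `|` D (false, true)) `|`
                            (D (true, false) `|` D (true, true))).
have GF : [set: circle R] `<=` G `|` F.
  move=> x _; have [Fx|nFx] := pselect (F x); [by right|left].
  have Yx : Y x by apply: contrapT => nYx; apply: nFx; left; left.
  have [W0 _ W1] : [/\ W x != 0%VS, (W x <= fullv)%VS & W x != fullv].
    by apply: contrapT => nWx; apply: nFx; left; right; apply: WN.
  have nD i : ~ D i x.
    by move=> Dx; apply: nFx; right; case: i Dx => -[] [] ?;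
      [right; right|right; left|left; right|left; left].
  have [v v0 Wv] := vspace_line W0 W1.
  have WTv := invariant_line_iter n TY AW Yx Wv.
  rewrite iter_rotation in WTv.
  have : 0 < cos ((pi * birkhoff_sum eta n x) *+ 2).
    apply: (same_double_coords_cos_gt0 v0) => i vi.
    apply/double_coord_line; rewrite -WTv.
    have [//|nETx] := pselect (E i (rotation (eta *+ n) x)).
    case: (nD i); split=> //; rewrite /E /preimage /= Wv.
    exact/double_coord_line.
  have [q ->] := birkhoff_sum_mod1 eta n x.
  rewrite (_ : _ *+ 2 = pi *+ 2 * (circle_val x *+ n) + b + pi *+ 2 * q%:~R).
    by rewrite cosD2pi_int.
  by rewrite /b -mulrnAl !mulrDr.
have mY' : measurable (~` Y) by exact: measurableC.
have mYN : measurable (~` Y `|` N) by exact: measurableU.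
have mD1 : measurable (D (false, false) `|` D (false, true)) by exact: measurableU.
have mD2 : measurable (D (true, false) `|` D (true, true)) by exact: measurableU.
have mDD := measurableU _ _ mD1 mD2.
have mF : measurable F by exact: measurableU.
have muF : (circle_lebesgue F <= (4^-1)%:E)%E.
  apply: (le_trans (measureU2 _ mYN mDD)).
  rewrite -[leRHS]add0e; apply: leeD.
    apply: (le_trans (measureU2 _ mY' mN)); rewrite -[leRHS]adde0.
    by apply: leeD; [rewrite [leLHS]muY|rewrite [leLHS]muN].
  rewrite (_ : 4^-1 = (16^-1 + 16^-1) + (16^-1 + 16^-1) :> R); last by field.
  apply: (le_trans (measureU2 _ mD1 mD2)); rewrite EFinD.
  have muDD i j : (circle_lebesgue (D i `|` D j) <= (16^-1 + 16^-1)%:E)%E.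
    apply: (le_trans (measureU2 _ (mD i) (mD j))).
    by rewrite EFinD; apply: leeD; exact: muD.
  by apply: leeD; exact: muDD.
have : (1 <= (2^-1)%:E + (4^-1)%:E :> \bar R)%E.
  rewrite -(@probability_setT _ _ _ (@circle_lebesgue R)).
  apply: (@le_trans _ _ (circle_lebesgue (G `|` F))).
    by apply: le_measure; rewrite ?inE//; exact: measurableU.
  by apply: (le_trans (measureU2 _ mG mF)); apply: leeD.
by rewrite -EFinD lee_fin; lra.
Qed.

Theorem proposition4p1 (R : realType) (eta : R) (eta_irrational : irrational eta) :
  reducible (@circle_lebesgue R) (rotation eta) (complex_cocycle eta)
    (trivial_bundle (circle R) (complex R) 2) /\
  irreducible (@circle_lebesgue R) (rotation eta) (real_cocycle eta)
    (trivial_bundle (circle R) R 2).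
Proof.
split; first exact: complex_bundle_reducible.
exact: real_bundle_irreducible.
Qed.
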